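(* Equip the abelian group $\mathbb{E}=S/B$ of Eudoxus reals with the multiplication $[f][g]=[f\circ g]$ and with the ordering whose set of positive elements is $P=\{[f] : f(m) \text{ takes on infinitely many positive values as } m \text{ ranges over } \mathbb{N}\}$. Then $\mathbb{E}$ is isomorphic to the ordered field $\mathbb{R}$ of real numbers.
   Context: A function $f:\mathbb{Z}\to\mathbb{Z}$ is an almost homomorphism iff the function $d_f(p,q)=f(p+q)-f(p)-f(q)$ from $\mathbb{Z}\times\mathbb{Z}$ to $\mathbb{Z}$ has bounded range, i.e. for some integer $C$, $|d_f(p,q)|<C$ for all $p,q\in\mathbb{Z}$. $S$ is the abelian group of all almost homomorphisms $\mathbb{Z}\to\mathbb{Z}$ under pointwise addition, and $B$ is the subgroup of all functions $\mathbb{Z}\to\mathbb{Z}$ with bounded range. The abelian group of Eudoxus reals is the quotient $\mathbb{E}=S/B$; $[f]$ denotes the class of $f\in S$. Here $\mathbb{N}$ denotes the non-negative integers, and membership of $P$ does not depend on the choice of representative. The ordering is $x<y$ iff $y-x\in P$. An isomorphism of ordered fields is a field isomorphism that preserves and reflects the ordering. *)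

(* Defs.v *)
From HB Require Import structures.
From mathcomp Require Import all_boot all_order all_algebra.
From mathcomp Require Import boolp classical_sets functions cardinality.
From mathcomp Require Import zify.

Set Implicit Arguments.
Unset Strict Implicit.
Unset Printing Implicit Defensive.

Import Order.TTheory GRing.Theory Num.Theory.

Local Open Scope classical_set_scope.
Local Open Scope ring_scope.
Local Open Scope quotient_scope.

Definition bounded_range (T : Type) (h : T -> int) : Prop :=
  exists C : int, forall t, `|h t| < C.

Definition almost_hom_defect (f : int -> int) (pq : int * int) : int :=
  f (pq.1 + pq.2) - f pq.1 - f pq.2.

Definition almost_hom : {pred (int -> int)} :=
  fun f => `[< bounded_range (almost_hom_defect f) >].

Lemma almost_homP (f : int -> int) :
  reflect (exists C : int, forall p q : int, `|f (p + q) - f p - f q| < C)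
          (f \in almost_hom).
Proof.
apply: (iffP (asboolP _)) => -[C HC]; exists C.
  by move=> p q; exact: (HC (p, q)).
by case=> p q; exact: HC.
Qed.

Lemma almost_hom_zmod_closed : zmod_closed almost_hom.
Proof.
split; first by apply/almost_homP; exists 1.
move=> f g /almost_homP[C HC] /almost_homP[D HD].
apply/almost_homP; exists (C + D) => p q; rewrite !fctE.
by have := HC p q; have := HD p q; lia.
Qed.

HB.instance Definition _ :=
  GRing.isZmodClosed.Build (int -> int) almost_hom almost_hom_zmod_closed.

(* S, whose addition is inherited from the pointwise one on int -> int. *)
Record almost_homs : Type := AlmostHom {
  almost_hom_fun :> int -> int;
  almost_hom_funP : almost_hom_fun \in almost_hom
}.
HB.instance Definition _ := [isSub for almost_hom_fun].
HB.instance Definition _ := [Choice of almost_homs by <:].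
HB.instance Definition _ := [SubChoice_isSubZmodule of almost_homs by <:].

Lemma bounded_almost_hom (f : int -> int) : bounded_range f -> f \in almost_hom.
Proof.
move=> [C HC]; apply/almost_homP; exists (C + C + C) => p q.
by have := HC (p + q); have := HC p; have := HC q; lia.
Qed.

(* B, as a predicate on S: by bounded_almost_hom, every function of bounded
   range lies in S. *)
Definition bounded_homs : {pred almost_homs} :=
  fun f => `[< bounded_range f >].

Lemma bounded_homs_zmod_closed : zmod_closed bounded_homs.
Proof.
split; first by apply/asboolP; exists 1.
move=> f g /asboolP[C HC] /asboolP[D HD].
apply/asboolP; exists (C + D) => p.
have -> : (f - g : almost_homs) p = f p - g p by [].
by have := HC p; have := HD p; lia.
Qed.

HB.instance Definition _ :=
  GRing.isZmodClosed.Build almost_homs bounded_homs bounded_homs_zmod_closed.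

Definition eudoxus : Type := Quotient.quot bounded_homs.
HB.instance Definition _ := EqQuotient.on eudoxus.
HB.instance Definition _ := GRing.Zmodule.on eudoxus.

Lemma eq_eudoxus (f g : almost_homs) :
  \pi_eudoxus f = \pi_eudoxus g <->
  exists C : int, forall p : int, `|f p - g p| < C.
Proof.
have E : (f - g \in bounded_homs) = (f == g %[mod eudoxus]).
  exact: Quotient.idealrBE.
split=> [/eqP|[C HC]].
  by rewrite -E => /asboolP[C HC]; exists C => p; have := HC p.
by apply/eqP; rewrite -E; apply/asboolP; exists C => p; exact: HC.
Qed.

Lemma bounded_on_interval (f : int -> int) (D : int) :
  exists C : int, forall r : int, `|r| < D -> `|f r| < C.
Proof.
suff H (n : nat) : exists C : int, forall r : int, `|r| < n%:Z -> `|f r| < C.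
  by have [C HC] := H `|D|%N; exists C => r Hr; apply: HC; lia.
elim: n => [|n [C HC]]; first by exists 0 => r; lia.
exists (`|C| + `|f n%:Z| + `|f (- n%:Z)| + 1) => r Hr.
have [Hn|Hn] := ltrP `|r| n%:Z; first by have := HC _ Hn; lia.
have [->|->] : r = n%:Z \/ r = - n%:Z by lia.
  by lia.
by lia.
Qed.

Lemma almost_hom_shift (f : int -> int) (D : int) : f \in almost_hom ->
  exists C : int, forall p r : int, `|r| < D -> `|f (p + r) - f p| < C.
Proof.
move=> /almost_homP[C HC]; have [M HM] := bounded_on_interval f D.
exists (C + M) => p r Hr.
by have := HC p r; have := HM r Hr; lia.
Qed.

Lemma almost_hom_comp (f g : int -> int) :
  f \in almost_hom -> g \in almost_hom -> f \o g \in almost_hom.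
Proof.
move=> Hf /almost_homP[D HD]; have [M HM] := almost_hom_shift D Hf.
case/almost_homP: Hf => C HC.
apply/almost_homP; exists (M + C) => p q /=.
have := HM (g p + g q) (g (p + q) - g p - g q) (HD p q).
have -> : g p + g q + (g (p + q) - g p - g q) = g (p + q) by lia.
by have := HC (g p) (g q); lia.
Qed.

Lemma almost_hom_id : (id : int -> int) \in almost_hom.
Proof. by apply/almost_homP; exists 1 => p q; lia. Qed.

Definition almost_homs_id : almost_homs := AlmostHom almost_hom_id.

Definition almost_homs_comp (f g : almost_homs) : almost_homs :=
  AlmostHom (almost_hom_comp (almost_hom_funP f) (almost_hom_funP g)).

Definition eudoxus_one : eudoxus := \pi_eudoxus almost_homs_id.

Definition eudoxus_mul : eudoxus -> eudoxus -> eudoxus :=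
  lift_op2 eudoxus almost_homs_comp.

Lemma pi_eudoxus_mul :
  {morph \pi_eudoxus : f g / almost_homs_comp f g >-> eudoxus_mul f g}.
Proof.
move=> f g; unlock eudoxus_mul; apply/eq_eudoxus => /=.
set f' := repr _; set g' := repr _.
have /eq_eudoxus[A HA] : \pi_eudoxus f = \pi_eudoxus f' by rewrite reprK.
have /eq_eudoxus[D HD] : \pi_eudoxus g = \pi_eudoxus g' by rewrite reprK.
have [M HM] := almost_hom_shift D (almost_hom_funP f').
exists (A + M) => p; have := HM (g' p) _ (HD p).
have -> : g' p + (g p - g' p) = g p by lia.
by have := HA (g p); lia.
Qed.

Canonical pi_eudoxus_mul_morph := PiMorph2 pi_eudoxus_mul.

(* Infinitely many positive values (not: positive at infinitely many m);
   m : nat is embedded in int by %:Z. *)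
Definition infinitely_many_positive_values (f : int -> int) : Prop :=
  infinite_set [set v : int | 0 < v /\ exists m : nat, f m%:Z = v].

Definition eudoxus_pos : set eudoxus :=
  [set \pi_eudoxus f | f in
     [set f : almost_homs | infinitely_many_positive_values f]].

Definition eudoxus_lt (x y : eudoxus) : Prop := eudoxus_pos (y - x).

(* Main.v *)
Require Import Defs.
From mathcomp Require Import all_boot all_order all_algebra reals.
From mathcomp Require Import boolp classical_sets functions cardinality.
From mathcomp Require Import zify ring lra.

Set Implicit Arguments.
Unset Strict Implicit.
Unset Printing Implicit Defensive.

Import Order.TTheory GRing.Theory Num.Theory.

Local Open Scope classical_set_scope.
Local Open Scope quotient_scope.
Local Open Scope ring_scope.

(** An almost homomorphism f stays within bounded distance of exactly one
    linear map p |-> a p, whose real coefficient a is called here its slope,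
    and the isomorphism sends the class of f to a.

    The slope exists ([has_slope_exists]) because a defect smaller than C makes
    n f(m) and m f(n) both close to f(mn), so that
    m f(n) - n f(m) <= C (m + n) for positive integers m and n.  After division
    by mn this says that the intervals [(f(n) - C)/n, (f(n) + C)/n], for n > 0,
    meet pairwise; completeness of the real numbers provides a point a common
    to all of them.  It is unique because a linear map bounded on the integers
    is zero.  Functions at bounded distance have the same slope and conversely
    ([has_slope_bounded]), so the slope is well defined and injective on S/B;
    it is onto because p |-> floor (a p) has slope a.  Slopes add under
    pointwise addition and multiply under composition, and f takes infinitely
    many positive values on the natural numbers iff its slope is positive
    ([has_slope_pos]). *)

(** * Slopes of integer functions *)

Definition has_slope (R : realType) (f : int -> int) (a : R) : Prop :=
  exists C : R, forall p : int, `|(f p)%:~R - a * p%:~R| <= C.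

Section Slope.
Context {R : realType}.
Implicit Types (f g : int -> int) (a b : R).

(** The Archimedean property, in contrapositive form. *)
Lemma linear_bounded_le0 a (C : R) :
  (forall n : nat, a * n%:R <= C) -> a <= 0.
Proof.
move=> aC; rewrite leNgt; apply/negP => a_gt0.
have := aC (Num.truncn (C / a)).+1; apply/negP; rewrite -ltNge.
by rewrite mulrC -ltr_pdivrMr// truncnS_gt.
Qed.

Lemma has_slope_unique f a b : has_slope f a -> has_slope f b -> a = b.
Proof.
move=> [C HC] [D HD]; apply/eqP; rewrite eq_le -(subr_le0 b) -(subr_le0 a).
apply/andP; split; apply: (@linear_bounded_le0 _ (C + D)) => n;
  have := HC n%:Z; have := HD n%:Z;
  by rewrite -!pmulrn !ler_norml; lra.
Qed.

(** Reaching p (n + 1) from p takes n additions of p, each of which costs an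
    error smaller than C. *)
Lemma almost_hom_mulrS f (C : int) :
  (forall p q, `|f (p + q) - f p - f q| < C) ->
  forall (n : nat) (p : int), `|f (p * n.+1%:Z) - f p * n.+1%:Z| <= C * n%:Z.
Proof.
move=> HC n p; elim: n => [|n IHn]; first by rewrite !mulr1 mulr0 subrr.
have := HC (p * n.+1%:Z) p.
have -> : p * n.+1%:Z + p = p * n.+2%:Z by lia.
by move: IHn; lia.
Qed.

Lemma has_slope_exists f : f \in almost_hom -> exists a, has_slope f a.
Proof.
case/almost_homP => C HC.
have cross (m n : nat) :
    (f n.+1%:Z - C) * m.+1%:Z <= (f m.+1%:Z + C) * n.+1%:Z.
  have := almost_hom_mulrS HC m n.+1%:Z; have := almost_hom_mulrS HC n m.+1%:Z.
  have C_gt0 : 0 < C := le_lt_trans (normr_ge0 _) (HC 0 0).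
  rewrite (mulrC m.+1%:Z n.+1%:Z).
  by move: (f (_ * _)) (f n.+1%:Z) (f m.+1%:Z) => x y z; lia.
(* The number f n is within C of a n iff a lies in the interval of endpoints
   lo and hi, which are indexed by the predecessor of n. *)
pose lo (n : nat) : R := (f n.+1%:Z - C)%:~R / n.+1%:R.
pose hi (n : nat) : R := (f n.+1%:Z + C)%:~R / n.+1%:R.
have lo_hi m n : lo n <= hi m.
  rewrite ler_pdivrMr ?ltr0Sn// mulrAC ler_pdivlMr ?ltr0Sn//.
  by rewrite !pmulrn -!intrM ler_int cross.
have lo0 : range lo !=set0 by exists (lo 0), 0%N.
have lo_ub : has_ubound (range lo) by exists (hi 0) => _ [n _ <-].
exists (sup (range lo)); set a := sup _.
have Ppos (n : nat) : `|(f n.+1%:Z)%:~R - a * n.+1%:R| <= C%:~R.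
  have : lo n <= a by apply: ub_le_sup => //; exists n.
  have : a <= hi n by apply: ge_sup => // _ [k _ <-].
  rewrite ler_pdivlMr ?ltr0Sn// ler_pdivrMr ?ltr0Sn// rmorphD rmorphB /=.
  by rewrite ler_norml; lra.
(* The defect at (0, 0) bounds f 0 by C, hence the one at (n, - n) bounds
   f n + f (- n) by 2 C; so a negative argument costs 2 C more than its
   opposite. *)
exists (3 * C%:~R) => p.
have C0 : `|(f 0)%:~R : R| <= C%:~R.
  by rewrite -intr_norm ler_int; have := HC 0 0; rewrite addr0; lia.
have C_ge0 : 0 <= C%:~R :> R := le_trans (normr_ge0 _) C0.
have CN (n : int) : `|(f n)%:~R + (f (- n))%:~R : R| <= 2 * C%:~R.
  rewrite -rmorphD -intr_norm -[2]/(2%:~R) -intrM ler_int.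
  have := HC n (- n); rewrite subrr; have := HC 0 0; rewrite addr0.
  by move: (f 0) (f n) (f (- n)) => x y z; lia.
case: (intP p) => [|n|n].
- by rewrite mulr0 subr0; lra.
- by have := Ppos n; rewrite -pmulrn; lra.
- have := Ppos n; have := CN n.+1%:Z; rewrite rmorphN /= -pmulrn mulrN.
  by rewrite !ler_norml; lra.
Qed.

Lemma has_slopeD f g a b :
  has_slope f a -> has_slope g b -> has_slope (f \+ g) (a + b).
Proof.
move=> [C HC] [D HD]; exists (C + D) => p; rewrite rmorphD mulrDl /=.
by have := HC p; have := HD p; rewrite !ler_norml; lra.
Qed.

Lemma has_slope_comp f g a b :
  has_slope f a -> has_slope g b -> has_slope (f \o g) (a * b).
Proof.
move=> [C HC] [D HD]; exists (C + `|a| * D) => p /=.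
have -> : (f (g p))%:~R - a * b * p%:~R =
  ((f (g p))%:~R - a * (g p)%:~R) + a * ((g p)%:~R - b * p%:~R) by ring.
by rewrite (le_trans (ler_normD _ _))// lerD// normrM ler_wpM2l.
Qed.

Lemma has_slope_id : has_slope id (1 : R).
Proof. by exists 0 => p; rewrite mul1r subrr normr0. Qed.

Lemma has_slope_floor a : has_slope (fun p => Num.floor (a * p%:~R)) a.
Proof.
exists 1 => p; have := floor_le (a * p%:~R); have := floorD1_gt (a * p%:~R).
by rewrite rmorphD /= ler_norml; lra.
Qed.

Lemma has_slope_almost_hom f a : has_slope f a -> f \in almost_hom.
Proof.
move=> [C HC]; apply/almost_homP; exists (Num.floor (3 * C) + 1) => p q.
rewrite -(ltr_int R) (le_lt_trans _ (floorD1_gt _))// intr_norm !rmorphB /=.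
have := HC (p + q); have := HC p; have := HC q; rewrite rmorphD mulrDr /=.
by rewrite !ler_norml; lra.
Qed.

(** Both well-definedness of the slope on classes and its injectivity. *)
Lemma has_slope_bounded f g a b : has_slope f a -> has_slope g b ->
  (exists C : int, forall p, `|f p - g p| < C) <-> a = b.
Proof.
move=> fa gb; split=> [[C HC]|ab].
  apply: has_slope_unique fa _; case: gb => D HD.
  exists (C%:~R + D) => p; have := HD p; have := HC p.
  by rewrite -(ltr_int R) intr_norm rmorphB /= !ler_norml ltr_norml; lra.
case: fa gb; rewrite -ab => C HC [D HD].
exists (Num.floor (C + D) + 1) => p.
rewrite -(ltr_int R) (le_lt_trans _ (floorD1_gt _))// intr_norm rmorphB /=.
by have := HC p; have := HD p; rewrite !ler_norml; lra.
Qed.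

Lemma finite_int_set_bounded (A : set int) :
  finite_set A -> exists M : int, forall v, A v -> v <= M.
Proof.
move=> /finite_seqP[s ->]; exists (\sum_(v <- s) `|v|) => v /= vs.
rewrite (le_trans (ler_norm v))// (big_rem v vs) /= lerDl.
exact: sumr_ge0.
Qed.

(** For a positive slope the values on the natural numbers are unbounded; for a
    slope at most 0 they are bounded above. *)
Lemma has_slope_pos f a :
  has_slope f a -> infinitely_many_positive_values f <-> 0 < a.
Proof.
move=> [C HC]; split=> [finf|a_gt0 /finite_int_set_bounded[M HM]].
  rewrite ltNge; apply/negP => a_le0; apply: finf.
  have fC (m : nat) : f m%:Z <= Num.floor C.
    rewrite floor_ge_int; have := HC m%:Z; rewrite ler_norml => /andP[_].
    have : a * m%:Z%:~R <= 0 by rewrite mulr_le0_ge0// ler0z.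
    by lra.
  apply: (@sub_finite_set _ _ (Posz @` `I_(`|Num.floor C|%N.+1))).
    move=> v [v0 [m mv]]; exists `|v|%N; last by lia.
    by rewrite /=; have := fC m; lia.
  exact/finite_image/finite_II.
suff : a <= 0 by rewrite leNgt a_gt0.
apply: (@linear_bounded_le0 _ (C + `|M|%:~R)) => n.
have fM : f n%:Z <= `|M|.
  have [f_le0|f_gt0] := lerP (f n%:Z) 0; first by lia.
  by have := HM (f n%:Z) (conj f_gt0 (ex_intro _ n erefl)); lia.
move: fM; rewrite -(ler_int R); have := HC n%:Z.
by rewrite -pmulrn ler_norml; lra.
Qed.

End Slope.

(** * The slope of a Eudoxus real *)

Section EudoxusSlope.
Context {R : realType}.

Definition eudoxus_slope (x : eudoxus) : R :=
  sval (cid (has_slope_exists (almost_hom_funP (repr x)))).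

Lemma has_slope_repr (x : eudoxus) : has_slope (repr x) (eudoxus_slope x).
Proof. exact: svalP (cid _). Qed.

Lemma eudoxus_slope_pi (f : almost_homs) a :
  has_slope f a -> eudoxus_slope (\pi_eudoxus f) = a.
Proof.
move=> fa; have := has_slope_repr (\pi_eudoxus f) => ra.
by apply/(has_slope_bounded ra fa)/eq_eudoxus; rewrite reprK.
Qed.

Lemma has_slope_pi (f : almost_homs) :
  has_slope f (eudoxus_slope (\pi_eudoxus f)).
Proof.
have [a fa] := has_slope_exists (R := R) (almost_hom_funP f).
by rewrite (eudoxus_slope_pi fa).
Qed.

Lemma eudoxus_slope_inj : injective eudoxus_slope.
Proof.
elim/quotW => f; elim/quotW => g fg; apply/eq_eudoxus.
exact/(has_slope_bounded (has_slope_pi f) (has_slope_pi g)).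
Qed.

Lemma eudoxus_slope_bij : bijective eudoxus_slope.
Proof.
pose h (a : R) : almost_homs :=
  AlmostHom (has_slope_almost_hom (has_slope_floor a)).
have hK : cancel (fun a => \pi_eudoxus (h a)) eudoxus_slope.
  by move=> a; exact/eudoxus_slope_pi/has_slope_floor.
by exists (fun a => \pi_eudoxus (h a)) => // x; apply: eudoxus_slope_inj.
Qed.

Lemma eudoxus_slopeD : {morph eudoxus_slope : x y / x + y}.
Proof.
elim/quotW => f; elim/quotW => g; rewrite -raddfD.
exact/eudoxus_slope_pi/(has_slopeD (has_slope_pi f) (has_slope_pi g)).
Qed.

Lemma eudoxus_slopeM : {morph eudoxus_slope : x y / eudoxus_mul x y >-> x * y}.
Proof.
elim/quotW => f; elim/quotW => g; rewrite -pi_eudoxus_mul.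
exact/eudoxus_slope_pi/(has_slope_comp (has_slope_pi f) (has_slope_pi g)).
Qed.

Lemma eudoxus_slope1 : eudoxus_slope eudoxus_one = 1.
Proof. exact/eudoxus_slope_pi/has_slope_id. Qed.

Lemma eudoxus_slope_gt0 (x : eudoxus) : eudoxus_pos x <-> 0 < eudoxus_slope x.
Proof.
split=> [[f fpos <-]|x_gt0]; first exact/(has_slope_pos (has_slope_pi f)).
by exists (repr x); [apply/(has_slope_pos (has_slope_repr x))|rewrite reprK].
Qed.

End EudoxusSlope.

Theorem mainTheorem1 (R : realType) :
  exists phi : eudoxus -> R,
    [/\ bijective phi,
        {morph phi : x y / x + y >-> x + y},
        {morph phi : x y / eudoxus_mul x y >-> x * y},
        phi eudoxus_one = 1 &
        forall x y : eudoxus, eudoxus_lt x y <-> phi x < phi y].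
Proof.
exists eudoxus_slope; split.
- exact: eudoxus_slope_bij.
- exact: eudoxus_slopeD.
- exact: eudoxus_slopeM.
- exact: eudoxus_slope1.
- move=> x y; apply: (iff_trans (@eudoxus_slope_gt0 R _)).
  have : eudoxus_slope (y - x + x) = eudoxus_slope y :> R by rewrite addrNK.
  by rewrite eudoxus_slopeD => <-; rewrite ltrDr; split.
Qed.
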